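(* Let $(M,\xi)$ be a contact manifold with a contact form $\lambda$, and let $\mathcal F$ and $\mathcal G$ be a co-Legendrian and the respective Legendrian foliations. Assume that the Reeb field of $\lambda$ is tangent to $\mathcal F$. Let $F$ be a leaf of $\mathcal F$. Then the 1-form $\lambda$ determines a holonomy invariant transverse smooth measure of the foliation $\mathcal G$ on the manifold $F$.
   Context: All objects are smooth. A contact manifold $(M^{2n-1},\xi)$ is a manifold of dimension $2n-1$ with a completely non-integrable hyperplane distribution $\xi$; a contact form $\lambda$ is a 1-form with $\ker\lambda=\xi$; its Reeb field $v$ is defined by $i_vd\lambda=0$, $\lambda(v)=1$. An $n$-dimensional foliation $\mathcal F$ is co-Legendrian if it is transverse to $\xi$ and $T\mathcal F\cap\xi$ is integrable; the integral foliation $\mathcal G$ of $T\mathcal F\cap\xi$ is the respective ($(n-1)$-dimensional) Legendrian foliation, which foliates each leaf $F$ of $\mathcal F$ with codimension one. That $\lambda$ determines a holonomy invariant transverse smooth measure of $\mathcal G$ on $F$ means that the restriction of $\lambda$ to $F$ is a basic form for the foliation $\mathcal G$ of $F$: $i_u\lambda|_F=0$ and $L_u\lambda|_F=0$ for every vector field $u$ on $F$ tangent to $\mathcal G$, so that it descends to a 1-form on the locally defined space of leaves of $\mathcal G$ in $F$. *)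

(* Defs.v *)
(* Manifolds are given by maximal C^infinity atlases.  A tangent vector at p is
   represented by its coordinates in a preferred chart [chart_at p] around p,
   so T_p M is 'rV[R]_m; [coords] and [frame] translate to and from the
   coordinates of any other chart.  *)
From HB Require Import structures.
From Stdlib Require Import Relation_Operators.
From mathcomp Require Import all_boot all_order all_algebra.
From mathcomp Require Import all_classical all_reals all_analysis.
Set Implicit Arguments.
Unset Strict Implicit.
Unset Printing Implicit Defensive.
Import Order.TTheory GRing.Theory Num.Theory.
Import numFieldNormedType.Exports.
Local Open Scope classical_set_scope.
Local Open Scope ring_scope.

(* Meant for open [U]; the values of [f] outside [U] do not matter then. *)
Fixpoint Ck (R : realType) (V W : normedModType R) (k : nat) (U : set V)
    (f : V -> W) : Prop :=
  if k is k'.+1 then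
    (forall x, U x -> differentiable f x) /\
    (forall v, Ck k' U (fun x => 'D_v f x))
  else forall x, U x -> {for x, continuous f}.

Definition smooth_on (R : realType) (V W : normedModType R) (U : set V)
    (f : V -> W) : Prop := forall k, Ck k U f.

(* [cmap] and [cinv] are total functions, relevant only on [cdom] and on its
   image respectively. *)
Record chart (R : realType) (m : nat) (T : topologicalType) := Chart {
  cdom : set T;
  cmap : T -> 'rV[R]_m;
  cinv : 'rV[R]_m -> T;
  cdom_open : open cdom;
  cimg_open : open (cmap @` cdom);
  cmapK : forall p, cdom p -> cinv (cmap p) = p;
  cmap_continuous : forall p, cdom p -> {for p, continuous cmap};
  cinv_continuous :
    forall x, (cmap @` cdom) x -> {for x, continuous cinv} }.

Definition smooth_transition (R : realType) (m : nat) (T : topologicalType)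
    (c c' : chart R m T) : Prop :=
  smooth_on (cmap c @` (cdom c `&` cdom c')) (cmap c' \o cinv c).

Definition compatible (R : realType) (m : nat) (T : topologicalType)
    (c c' : chart R m T) : Prop :=
  smooth_transition c c' /\ smooth_transition c' c.

Record manifold (R : realType) (m : nat) := Manifold {
  carrier :> topologicalType;
  atlas : set (chart R m carrier);
  chart_at : carrier -> chart R m carrier;
  manifold_hausdorff : hausdorff_space carrier;
  manifold_second_countable : @second_countable carrier;
  atlas_compatible : forall c c', atlas c -> atlas c' -> compatible c c';
  atlas_maximal :
    forall c, (forall c', atlas c' -> compatible c c') -> atlas c;
  chart_at_atlas : forall p, atlas (chart_at p);
  chart_at_dom : forall p, cdom (chart_at p) p }.

Definition coords (R : realType) (m : nat) (M : manifold R m)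
    (c : chart R m M) (p : M) : 'rV[R]_m -> 'rV[R]_m :=
  'd (cmap c \o cinv (chart_at p)) (cmap (chart_at p) p).

Definition frame (R : realType) (m : nat) (M : manifold R m)
    (c : chart R m M) (p : M) : 'rV[R]_m -> 'rV[R]_m :=
  'd (cmap (chart_at p) \o cinv c) (cmap c p).

Definition smooth_map (R : realType) (n m : nat) (N : manifold R n)
    (M : manifold R m) (f : N -> M) : Prop :=
  continuous f /\
  forall c c', atlas c -> atlas c' ->
    smooth_on (cmap c @` (cdom c `&` f @^-1` cdom c'))
      (cmap c' \o f \o cinv c).

Definition tmap (R : realType) (n m : nat) (N : manifold R n)
    (M : manifold R m) (f : N -> M) (x : N) :
    {linear 'rV[R]_n -> 'rV[R]_m} :=
  'd (cmap (chart_at (f x)) \o f \o cinv (chart_at x)) (cmap (chart_at x) x).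

(* No smoothness is built into the next three types.  A [plane_field] is a
   distribution in the sense of differential geometry. *)

Definition vector_field (R : realType) (m : nat) (M : manifold R m) :=
  M -> 'rV[R]_m.

Definition one_form (R : realType) (m : nat) (M : manifold R m) :=
  M -> {scalar 'rV[R]_m}.

Definition plane_field (R : realType) (m : nat) (M : manifold R m) :=
  M -> set 'rV[R]_m.

Definition vf_in (R : realType) (m : nat) (M : manifold R m)
    (c : chart R m M) (u : vector_field M) (x : 'rV[R]_m) : 'rV[R]_m :=
  coords c (cinv c x) (u (cinv c x)).

Definition form_in (R : realType) (m : nat) (M : manifold R m)
    (c : chart R m M) (a : one_form M) (x w : 'rV[R]_m) : R :=
  a (cinv c x) (frame c (cinv c x) w).

Definition smooth_vf (R : realType) (m : nat) (M : manifold R m)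
    (u : vector_field M) : Prop :=
  forall c, atlas c -> smooth_on (cmap c @` cdom c) (vf_in c u).

Definition smooth_form_on (R : realType) (m : nat) (M : manifold R m)
    (U : set M) (a : one_form M) : Prop :=
  forall c, atlas c -> forall w,
    smooth_on (cmap c @` (cdom c `&` U)) (fun x => form_in c a x w).

Definition smooth_form (R : realType) (m : nat) (M : manifold R m)
    (a : one_form M) : Prop := smooth_form_on setT a.

(* d a (v, w) = v (a w) - w (a v) - a [v, w], with v and w extended to the
   domain of [chart_at p] with constant coordinates, so that [v, w] = 0. *)
Definition dform (R : realType) (m : nat) (M : manifold R m)
    (a : one_form M) (p : M) (v w : 'rV[R]_m) : R :=
  let c := chart_at p in
  'D_v (fun x => form_in c a x w) (cmap c p)
  - 'D_w (fun x => form_in c a x v) (cmap c p).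

(* (L_u a) w = u (a w) - a [u, w], with w extended with constant coordinates,
   so that [u, w] is minus the derivative of u in the direction w. *)
Definition lie_form (R : realType) (m : nat) (M : manifold R m)
    (u : vector_field M) (a : one_form M) (p : M) (w : 'rV[R]_m) : R :=
  let c := chart_at p in
  'D_(u p) (fun x => form_in c a x w) (cmap c p)
  + a p ('D_w (vf_in c u) (cmap c p)).

Definition pullback (R : realType) (n m : nat) (N : manifold R n)
    (M : manifold R m) (f : N -> M) (a : one_form M) : one_form N :=
  fun x => a (f x) \o tmap f x.

Definition preimage_plane_field (R : realType) (n m : nat)
    (N : manifold R n) (M : manifold R m) (f : N -> M) (D : plane_field M) :
    plane_field N :=
  fun x => tmap f x @^-1` D (f x).

Definition dist_cap (R : realType) (m : nat) (M : manifold R m)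
    (D E : plane_field M) : plane_field M := fun p => D p `&` E p.

Definition transverse (R : realType) (m : nat) (M : manifold R m)
    (D E : plane_field M) : Prop :=
  forall p w, exists v1 v2, [/\ D p v1, E p v2 & w = v1 + v2].

(* Foliations: the first [k] coordinates of a foliated chart are those along
   the plaques. *)

Definition same_plaque (R : realType) (m k : nat) (T : topologicalType)
    (c : chart R m T) (p q : T) : Prop :=
  [/\ cdom c p, cdom c q &
      forall j : 'I_m, (k <= j)%N -> cmap c p 0 j = cmap c q 0 j].

Definition open_box (R : realType) (m : nat) (a b : 'rV[R]_m) :
    set 'rV[R]_m :=
  [set x | forall j, a 0 j < x 0 j < b 0 j].

(* Foliated charts have boxes as images, so plaques are connected. *)
Record foliation (R : realType) (m : nat) (M : manifold R m) (k : nat) :=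
  Foliation {
    fatlas : set (chart R m M);
    fol_dim : (k <= m)%N;
    fatlas_atlas : fatlas `<=` @atlas R m M;
    fatlas_cover : forall p : M, exists2 c, fatlas c & cdom c p;
    fatlas_box : forall c, fatlas c ->
      exists a b, cmap c @` cdom c = open_box a b;
    fatlas_coherent : forall c c' p, fatlas c -> fatlas c' ->
      cdom c p -> cdom c' p ->
      exists2 W, nbhs p W &
        forall q r, W q -> W r -> same_plaque k c q r -> same_plaque k c' q r
  }.

Definition tangent (R : realType) (m : nat) (M : manifold R m) (k : nat)
    (F : foliation M k) : plane_field M :=
  fun p => [set w | forall c, fatlas F c -> cdom c p ->
    forall j : 'I_m, (k <= j)%N -> coords c p w 0 j = 0].

Definition same_leaf (R : realType) (m : nat) (M : manifold R m) (k : nat)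
    (F : foliation M k) : M -> M -> Prop :=
  clos_refl_trans M
    (fun p q => exists2 c, fatlas F c & same_plaque k c p q).

(* A leaf, with its own manifold structure [L]: an injectively immersed
   integral manifold [i : L -> M] whose image is a class of [same_leaf].  The
   tangency condition makes [i] a local diffeomorphism to the plaques, so the
   manifold structure of [L] is determined by its image. *)
Definition is_leaf (R : realType) (m : nat) (M : manifold R m) (k : nat)
    (F : foliation M k) (L : manifold R k) (i : L -> M) : Prop :=
  [/\ smooth_map i, injective i,
      forall x, injective (tmap i x),
      forall x, range (tmap i x) = tangent F (i x) &
      exists p, range i = [set q | same_leaf F p q]].

Definition integral_foliation (R : realType) (m : nat) (M : manifold R m)
    (k : nat) (D : plane_field M) (G : foliation M k) : Prop :=
  forall p, tangent G p = D p.

Definition integrable_plane_field (R : realType) (m : nat)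
    (M : manifold R m) (k : nat) (D : plane_field M) : Prop :=
  exists G : foliation M k, integral_foliation D G.

(* [xi] is locally the kernel of a nowhere zero smooth 1-form [a]; complete
   non-integrability is the non-degeneracy of [d a] on [xi]. *)
Definition contact_structure (R : realType) (m : nat) (M : manifold R m)
    (xi : plane_field M) : Prop :=
  forall p, exists (U : set M) (a : one_form M),
    [/\ open U, U p, smooth_form_on U a,
        forall q, U q ->
          (exists w, a q w != 0) /\ xi q = [set w | a q w = 0] &
        forall q v, U q -> xi q v ->
          (forall w, xi q w -> dform a q v w = 0) -> v = 0].

Definition contact_form (R : realType) (m : nat) (M : manifold R m)
    (xi : plane_field M) (lam : one_form M) : Prop :=
  smooth_form lam /\ forall p, [set w | lam p w = 0] = xi p.

Definition reeb_field (R : realType) (m : nat) (M : manifold R m)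
    (lam : one_form M) (v : vector_field M) : Prop :=
  [/\ smooth_vf v,
      forall p w, dform lam p (v p) w = 0 &
      forall p, lam p (v p) = 1].

Definition co_legendrian (R : realType) (n : nat)
    (M : manifold R (2 * n - 1)) (xi : plane_field M) (F : foliation M n) :
    Prop :=
  transverse (tangent F) xi /\
  integrable_plane_field (n - 1) (dist_cap (tangent F) xi).

(* [G] is the Legendrian foliation of the co-Legendrian foliation [F]. *)
Definition legendrian_of (R : realType) (n : nat)
    (M : manifold R (2 * n - 1)) (xi : plane_field M) (F : foliation M n)
    (G : foliation M (n - 1)) : Prop :=
  integral_foliation (dist_cap (tangent F) xi) G.

(* [a] is a basic 1-form for the foliation of [N] with tangent distribution
   [D]: smooth, with vanishing contraction and Lie derivative along every
   vector field tangent to the foliation. *)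
Definition holonomy_invariant_transverse_measure (R : realType) (m : nat)
    (N : manifold R m) (D : plane_field N) (a : one_form N) : Prop :=
  smooth_form a /\
  forall u : vector_field N, smooth_vf u -> (forall x, D x (u x)) ->
    (forall x, a x (u x) = 0) /\ (forall x w, lie_form u a x w = 0).

(* Main.v *)
From HB Require Import structures.
Require Import Defs.
From mathcomp Require Import all_boot all_order all_algebra.
From mathcomp Require Import all_classical all_reals all_analysis.
From mathcomp Require Import ring.

(** Let [a] be the restriction of [lam] to the leaf [L].  A vector [u] tangent
    to the Legendrian foliation lies in [xi = ker lam], so [a u = 0]; Cartan's
    formula then reduces the Lie derivative [L_u a] to the contraction of [u]
    with [d a] ([lie_form_dform]).  By naturality of the exterior derivative
    ([dform_pullback]) the claim becomes [d lam (u, w) = 0] for [u] tangent to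
    [G] and [w] tangent to [F].  Since the Reeb field [v] is tangent to [F] and
    [lam v = 1], the vector [w - lam w *: v] is tangent to [F] and killed by
    [lam], that is, tangent to [G]; so [w] is a multiple of [v] plus a vector
    tangent to [G].  The multiple of [v] contributes nothing because [v] lies
    in the kernel of [d lam], and the other part contributes nothing because
    [lam] vanishes on the leaves of [G], hence so does [d lam]
    ([dform_integral]).

    The last fact is read off in a foliated chart of [G], where [lam] has no
    component along the plaques.  Exterior and Lie derivatives are however
    taken in the preferred chart of each point, so everything rests on the
    invariance of the exterior derivative under smooth maps, in particular
    under changes of chart ([dcoord_pullback]).  There the second derivatives
    of the map cancel by their symmetry ([schwarz]), which follows from the
    mean value theorem. *)

Set Implicit Arguments.
Unset Strict Implicit.
Unset Printing Implicit Defensive.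
Import Order.TTheory GRing.Theory Num.Theory.
Import numFieldNormedType.Exports.
Local Open Scope classical_set_scope.
Local Open Scope ring_scope.

(** * Symmetry of second derivatives *)

Lemma near_eq_differentiable (R : realType) (V W : normedModType R)
    (f g : V -> W) (x : V) :
  (\near x, f x = g x) -> differentiable f x -> differentiable g x.
Proof.
move=> fg fx.
have E : g \o shift x = cst (g x) + 'd f x +o_ 0 id.
  apply/eqaddoP => _/posnumP[e].
  have := fx => /diff_locally /eqaddoP /(_ e%:num (gt0 e)) H.
  rewrite -(nbhs_singleton fg).
  have fg0 : \forall y \near (0 : V), f (y + x) = g (y + x).
    by move: fg; rewrite (near_shift 0 x) /= subr0.
  have H' : \forall y \near (0 : V), `|(f \o shift x - (cst (f x) + 'd f x)) y|
      <= e%:num * `|y| by [].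
  suff : \forall y \near (0 : V), `|(g \o shift x - (cst (f x) + 'd f x)) y|
      <= e%:num * `|y| by [].
  near=> y.
  rewrite -[(g \o _ - _) y]/(g (y + x) - _) -(near fg0 y) //.
  exact: (near H' y).
have cd : continuous ('d f x) by exact: diff_continuous.
have dE := diff_unique cd E.
by apply/diff_locallyP; rewrite dE.
Unshelve. all: by end_near. Qed.

Lemma derivable_line (R : realType) (V : normedModType R) (f : V -> R)
    (p u : V) (s : R) :
  differentiable f (p + s *: u) ->
  is_derive s 1 (fun t => f (p + t *: u)) ('D_u f (p + s *: u)).
Proof.
move=> df.
have dl : is_diff s (fun t : R => p + t *: u) ( *:%R^~ u).
  apply: is_diff_eq; rewrite funeqE => t /=; exact: add0r.
have dc : differentiable (f \o (fun t : R => p + t *: u)) s.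
  by apply: differentiable_comp.
apply: DeriveDef; first exact/diff_derivable.
rewrite deriveE // diff_comp // /comp /= deriveE //.
by rewrite (@diff_val _ _ _ _ _ _ _ dl) scale1r.
Qed.

Lemma MVT_line (R : realType) (V : normedModType R) (f : V -> R)
    (p u : V) (t : R) : 0 < t ->
  (forall s, 0 <= s <= t -> differentiable f (p + s *: u)) ->
  exists2 s, 0 <= s <= t & f (p + t *: u) - f p = t * 'D_u f (p + s *: u).
Proof.
move=> t0 df.
have [||s] := @MVT_segment R (fun s => f (p + s *: u))
  (fun s => 'D_u f (p + s *: u)) 0 t (ltW t0).
- move=> s; rewrite in_itv /= => /andP[s0 st]; apply: derivable_line.
  by apply: df; rewrite !ltW.
- apply: derivable_within_continuous => s; rewrite in_itv /= => st.
  exact: (@ex_derive _ _ _ _ _ _ _ (derivable_line (df _ st))).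
rewrite in_itv /= => st; rewrite scale0r addr0 subr0 => ->.
by exists s => //; rewrite mulrC.
Qed.

Lemma derive_translate (R : realType) (V W : normedModType R) (f : V -> W)
    (p u w : V) : 'D_u (fun y => f (y + w)) p = 'D_u f (p + w).
Proof.
rewrite /derive; set d := (fun h => _); set d' := (fun h => _).
by suff -> : d = d' by []; apply/funext => h; rewrite /d /d' /= addrA.
Qed.

(** Two applications of the mean value theorem: the second difference of [f]
    over a parallelogram of side [t] is [t ^+ 2] times a mixed derivative at
    one of its points.  The difference does not change when [u] and [v] are
    exchanged, which is what makes the mixed derivatives agree in the limit. *)
Lemma second_difference (R : realType) (V : normedModType R) (f : V -> R)
    (p u v : V) (t : R) : 0 < t ->
  (forall s s', 0 <= s <= t -> 0 <= s' <= t ->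
     differentiable f (p + s *: u + s' *: v) /\
     differentiable (fun y => 'D_u f y) (p + s *: u + s' *: v)) ->
  exists s s', [/\ 0 <= s <= t, 0 <= s' <= t &
    f (p + t *: u + t *: v) - f (p + t *: u) - (f (p + t *: v) - f p)
    = t ^+ 2 * 'D_v (fun y => 'D_u f y) (p + s *: u + s' *: v)].
Proof.
move=> t0 df.
have tt : 0 <= t <= t by apply/andP; split => //; exact: ltW.
have t00 : 0 <= (0 : R) <= t by apply/andP; split => //; exact: ltW.
have dtr s : 0 <= s <= t ->
    differentiable (fun y => f (y + t *: v)) (p + s *: u).
  move=> st; apply: (@differentiable_comp _ _ _ _ (fun y => y + t *: v) f)=> //.
  exact: (df _ _ st tt).1.
have d0 s : 0 <= s <= t -> differentiable f (p + s *: u).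
  by move=> st; have := (df _ _ st t00).1; rewrite scale0r addr0.
have [s st Es] := MVT_line (f := fun y => f (y + t *: v) - f y) t0
   (fun s st => differentiableB (dtr s st) (d0 s st)).
have [s' st' Es'] := MVT_line (f := fun y => 'D_u f y) t0
   (fun s' st' => (df _ _ st st').2).
exists s, s'; split => //.
rewrite Es deriveB; try by apply: diff_derivable; auto.
by rewrite derive_translate Es' mulrA.
Qed.

Lemma eq_of_common_approx (R : realType) (a b : R) :
  (forall e, 0 < e -> exists c, `|a - c| < e /\ `|b - c| < e) -> a = b.
Proof.
move=> ab; apply/eqP/negPn/negP => neq_ab.
have /ab[c [ac bc]] : 0 < `|a - b| / 2.
  by rewrite divr_gt0 // normr_gt0 subr_eq0.
have := le_lt_trans (ler_distD c a b) (ltrD ac _).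
by rewrite (distrC c b) => /(_ _ bc); rewrite -splitr ltxx.
Qed.

(** Both mixed derivatives are approximated, by continuity, by the same second
    difference quotient over a small parallelogram. *)
Lemma schwarz (R : realType) (V : normedModType R) (U : set V) (f : V -> R)
    (u v x : V) : open U -> U x -> Ck 2 U f ->
  'D_v (fun y => 'D_u f y) x = 'D_u (fun y => 'D_v f y) x.
Proof.
move=> Uo Ux [df d2f].
have ca := (d2f u).2 v x Ux; have cb := (d2f v).2 u x Ux.
apply: eq_of_common_approx => e e0.
move/cvgrPdist_lt : ca => /(_ e e0) na.
move/cvgrPdist_lt : cb => /(_ e e0) nb.
have nU : nbhs x U by exact: open_nbhs_nbhs.
have [r /= r0 rP] := (nbhs_ballP _ _).1 (filterI nU (filterI na nb)).
(* This side is small enough for the parallelogram to stay in the ball. *)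
pose t := r / (2 * (`|u| + `|v| + 1)).
have uv0 : 0 < `|u| + `|v| + 1 by rewrite ltr_wpDl // addr_ge0.
have t0 : 0 < t by rewrite divr_gt0 // mulr_gt0.
have inb s s' : 0 <= s <= t -> 0 <= s' <= t ->
    ball x r (x + s *: u + s' *: v).
  move=> /andP[s0 st] /andP[s'0 s't].
  rewrite -ball_normE /ball_ /= -addrA opprD addrA subrr add0r normrN.
  rewrite (le_lt_trans (ler_normD _ _)) // !normrZ !ger0_norm //.
  apply: (@le_lt_trans _ _ (t * (`|u| + `|v| + 1))).
    rewrite !mulrDr -addrA lerD ?ler_wpM2r //.
    by rewrite ler_wpDr ?mulr1 ?ler_wpM2r // ltW.
  by rewrite /t invfM mulrA divfK ?gt_eqF // ltr_pdivrMr // ltr_pMr // ltr1n.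
have [|s [s' [st st' E1]]] := @second_difference _ _ f x u v t t0.
  move=> s s' st st'; have [Us _] := rP _ (inb _ _ st st').
  by split; [exact: df|exact: (d2f u).1].
have [|z [z' [zt zt' E2]]] := @second_difference _ _ f x v u t t0.
  move=> z z' zt zt'; have [Uz _] := rP _ (inb _ _ zt' zt).
  by rewrite addrAC; split; [exact: df|exact: (d2f v).1].
have t2 : t ^+ 2 != 0 by rewrite expf_neq0 // gt_eqF.
have E : 'D_v (fun y => 'D_u f y) (x + s *: u + s' *: v) =
         'D_u (fun y => 'D_v f y) (x + z' *: u + z *: v).
  apply: (mulfI t2); apply: etrans (esym E1) _.
  rewrite (addrAC x (z' *: u)); apply: etrans E2.
  by rewrite (addrAC x (t *: v)); ring.
exists ('D_v (fun y => 'D_u f y) (x + s *: u + s' *: v)); split.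
  exact: (rP _ (inb _ _ st st')).2.1.
by rewrite E; exact: (rP _ (inb _ _ zt' zt)).2.2.
Qed.

(** * Calculus of maps of class C^k *)

(** Lets smoothness be checked with one pair of charts around each point. *)
Lemma Ck_local (R : realType) (V W : normedModType R) k (U : set V)
    (f : V -> W) :
  (forall x, U x -> exists2 U', U' x & Ck k U' f) -> Ck k U f.
Proof.
elim: k f => [|k IH] f loc /=.
  by move=> x /loc[U' U'x]; apply.
split=> [x /loc[U' U'x [df _]]|v]; first exact: df.
by apply: IH => x /loc[U' U'x [_ dvf]]; exists U' => //; exact: dvf.
Qed.

Lemma eq_Ck (R : realType) (V W : normedModType R) k (U : set V)
    (f g : V -> W) :
  open U -> (forall x, U x -> f x = g x) -> Ck k U f -> Ck k U g.
Proof.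
move=> Uo.
have nearU h h' x : U x -> (forall y, U y -> h y = h' y :> W) ->
    \forall y \near x, h y = h' y.
  by move=> Ux hh'; apply: filterS hh' _; exact: open_nbhs_nbhs.
elim: k f g => [|k IH] f g fg /=.
  move=> fc x Ux; have fgx := nearU _ _ _ Ux fg.
  suff : g y @[y --> x] --> g x by []; rewrite -(fg x Ux).
  by apply: cvg_trans (fc x Ux); apply: near_eq_cvg; exact: fgx.
move=> [df dvf]; split=> [x Ux|v].
  exact: near_eq_differentiable (nearU _ _ _ Ux fg) (df x Ux).
apply: IH (dvf v) => x Ux; exact: near_eq_derive (nearU _ _ _ Ux fg).
Qed.

Lemma CkW (R : realType) (V W : normedModType R) k (U : set V) (f : V -> W) :
  Ck k.+1 U f -> Ck k U f.
Proof.
elim: k f => [|k IH] f [df dvf].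
  by move=> x /df/differentiable_continuous.
by split => // v; apply: IH.
Qed.

Lemma Ck_cst (R : realType) (V W : normedModType R) k (U : set V) (a : W) :
  Ck k U (fun=> a).
Proof.
elim: k a => [|k IH] a /=; first by move=> x _; exact: cvg_cst.
split=> // v.
have -> : (fun x : V => 'D_v (fun=> a) x) = fun=> 0.
  by apply/funext => x; rewrite derive_cst.
exact: IH.
Qed.

Lemma CkD (R : realType) (V W : normedModType R) k (U : set V) (f g : V -> W) :
  open U -> Ck k U f -> Ck k U g -> Ck k U (fun x => f x + g x).
Proof.
move=> Uo; elim: k f g => [|k IH] f g /=.
  by move=> fc gc x Ux; apply: cvgD; [exact: fc|exact: gc].
move=> [df dvf] [dg dvg]; split=> [x Ux|v].
  by apply: differentiableD; auto.
apply: eq_Ck (IH _ _ (dvf v) (dvg v)) => // x Ux.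
by rewrite deriveD //; apply: diff_derivable; auto.
Qed.

Lemma Ck_sum (R : realType) (V W : normedModType R) k (U : set V) (m : nat)
    (f : 'I_m -> V -> W) :
  open U -> (forall j, Ck k U (f j)) -> Ck k U (fun x => \sum_j f j x).
Proof.
move=> Uo fk; elim: (index_enum _) => [|j s IH].
  by under eq_fun do rewrite big_nil; exact: Ck_cst.
by under eq_fun do rewrite big_cons; exact: CkD.
Qed.

Lemma CkM (R : realType) (V : normedModType R) k (U : set V) (f g : V -> R) :
  open U -> Ck k U f -> Ck k U g -> Ck k U (fun x => f x * g x).
Proof.
move=> Uo; elim: k f g => [|k IH] f g.
  by move=> fc gc x Ux; apply: cvgM; [exact: fc|exact: gc].
move=> fk gk; have [df dvf] := fk; have [dg dvg] := gk.
split=> [x Ux|v]; first by apply: differentiableM; auto.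
apply: (@eq_Ck _ _ _ _ _ (fun x => f x * 'D_v g x + g x * 'D_v f x)) => //.
  by move=> x Ux; rewrite deriveM //; apply: diff_derivable; auto.
apply: CkD => //; apply: IH; [exact: CkW|exact: dvg|exact: CkW|exact: dvf].
Qed.

Lemma Ck_coord (R : realType) (V : normedModType R) m k (U : set V)
    (f : V -> 'rV[R]_m) (j : 'I_m) :
  open U -> Ck k U f -> Ck k U (fun x => f x 0 j).
Proof.
move=> Uo; elim: k f => [|k IH] f.
  move=> fc x Ux.
  apply: (@continuous_comp _ _ _ f (fun M => M 0 j)) (fc x Ux) _.
  exact: coord_continuous.
move=> [df dvf]; split=> [x Ux|v].
  apply: (@differentiable_comp _ _ _ _ f (fun M => M 0 j)); first exact: df.
  exact: differentiable_coord.
apply: eq_Ck (IH _ (dvf v)) => // x Ux.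
by rewrite derive_mx ?mxE //; apply: diff_derivable; exact: df.
Qed.

Lemma scalar_sum_coord (R : realType) m (a : 'rV[R]_m -> R) (w : 'rV[R]_m) :
  scalar a -> a w = \sum_j w 0 j * a (delta_mx 0 j).
Proof.
move=> aL.
pose A : {scalar 'rV[R]_m} := HB.pack a
  (GRing.isLinear.Build _ _ _ _ _ aL).
rewrite [in LHS](row_sum_delta w) -[a]/(A : _ -> _) linear_sum.
by apply: eq_bigr => j _; rewrite linearZ.
Qed.

(** By the chain rule, the derivative of the composite in the direction [v] is
    the sum of the products of the coordinates of ['D_v f] with the partial
    derivatives of [h] along [f], so induction on [k] applies. *)
Lemma Ck_comp (R : realType) m (V : normedModType R) k (U : set V)
   (U' : set 'rV[R]_m) (f : V -> 'rV[R]_m) (h : 'rV[R]_m -> R) :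
  open U -> (forall x, U x -> U' (f x)) ->
  Ck k U f -> Ck k U' h -> Ck k U (fun x => h (f x)).
Proof.
move=> Uo fU; elim: k h => [|k IH] h.
  move=> fc hc x Ux.
  exact: (@continuous_comp _ _ _ f h) (fc x Ux) (hc _ (fU _ Ux)).
move=> fk; have [df dvf] := fk; move=> [dh dvh].
split=> [x Ux|v].
  by apply: (@differentiable_comp _ _ _ _ f h); [exact: df|exact/dh/fU].
apply: (@eq_Ck _ _ _ _ _
   (fun x => \sum_j ('D_v f x) 0 j * 'D_(delta_mx 0 j) h (f x))) => //.
  move=> x Ux; have dhf : differentiable h (f x) by exact/dh/fU.
  rewrite [RHS]deriveE; last by apply: (@differentiable_comp _ _ _ _ f h); auto.
  rewrite (@diff_comp _ _ _ _ f h) //=; last exact: df.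
  rewrite -(deriveE _ (df x Ux)) [RHS]scalar_sum_coord.
    by apply: eq_bigr => j _; rewrite (deriveE _ dhf).
  by move=> a u w; exact: linearP.
apply: Ck_sum => // j; apply: CkM => //; first exact/Ck_coord/dvf.
by apply: (IH (fun y => 'D_(delta_mx 0 j) h y)); [exact: CkW|exact: dvh].
Qed.

(** * The exterior derivative in coordinates *)

Lemma derive_comp (R : realType) (V W X : normedModType R) (f : V -> W)
    (h : W -> X) (x v : V) :
  differentiable f x -> differentiable h (f x) ->
  'D_v (fun y => h (f y)) x = 'D_('D_v f x) h (f x).
Proof.
move=> df dh; rewrite deriveE; last exact: (@differentiable_comp _ _ _ _ f h).
by rewrite (@diff_comp _ _ _ _ f h) //= !deriveE.
Qed.

Lemma derive_coord (R : realType) (V : normedModType R) m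
    (f : V -> 'rV[R]_m) (v x : V) (j : 'I_m) :
  differentiable f x -> ('D_v f x) 0 j = 'D_v (fun y => f y 0 j) x.
Proof. by move=> df; rewrite derive_mx ?mxE //; exact: diff_derivable. Qed.

Lemma schwarz_row (R : realType) m (V : normedModType R) (U : set V)
    (f : V -> 'rV[R]_m) (u v x : V) : open U -> U x -> Ck 2 U f ->
  'D_v (fun y => 'D_u f y) x = 'D_u (fun y => 'D_v f y) x.
Proof.
move=> Uo Ux f2; have [df d2f] := f2.
apply/rowP => j.
have coordE w w' : ('D_w (fun y => 'D_w' f y) x) 0 j =
    'D_w (fun y => 'D_w' (fun z => f z 0 j) y) x.
  apply: etrans (derive_coord _ _ ((d2f w').1 x Ux)) _.
  apply: near_eq_derive.
  have nU : \forall y \near x, U y by exact: open_nbhs_nbhs.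
  by apply: filterS nU => y Uy; exact: derive_coord (df y Uy).
apply: etrans (coordE v u) (etrans _ (esym (coordE u v))).
exact: schwarz Uo Ux (Ck_coord j Uo f2).
Qed.

Lemma Ck_contract (R : realType) (V : normedModType R) m k (U : set V)
    (A : V -> 'rV[R]_m -> R) (f : V -> 'rV[R]_m) :
  open U -> (forall y, scalar (A y)) -> (forall w, Ck k U (fun y => A y w)) ->
  Ck k U f -> Ck k U (fun y => A y (f y)).
Proof.
move=> Uo AL Ak fk; under eq_fun => y do rewrite (scalar_sum_coord _ (AL y)).
by apply: Ck_sum => // j; apply: CkM => //; exact: Ck_coord.
Qed.

(** Leibniz rule for the contraction of a field of covectors [A] with a vector
    field [f]. *)
Lemma derive_contract (R : realType) (V : normedModType R) m
    (A : V -> 'rV[R]_m -> R) (f : V -> 'rV[R]_m) (x v : V) :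
  (forall y, scalar (A y)) -> (forall w, differentiable (fun y => A y w) x) ->
  differentiable f x ->
  'D_v (fun y => A y (f y)) x = 'D_v (fun y => A y (f x)) x + A x ('D_v f x).
Proof.
move=> AL dA df.
have dfj j : derivable (fun y => f y 0 j) x v.
  by apply: (derivable_mxP f x v).1; exact: diff_derivable.
have dAj w : derivable (fun y => A y w) x v by exact: diff_derivable.
under eq_fun => y do rewrite (scalar_sum_coord _ (AL y)).
rewrite -[fun y => \sum_j _]fct_sumE.
rewrite derive_sum => [|j]; last by apply: derivableM.
under [in RHS]eq_fun => y do rewrite (scalar_sum_coord _ (AL y)).
rewrite -[fun y => \sum_j _]fct_sumE.
rewrite derive_sum => [|j]; last first.
  by apply: derivableM => //; exact: derivable_cst.
rewrite (scalar_sum_coord _ (AL x)) -big_split; apply: eq_bigr => j _ /=.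
rewrite deriveM // deriveM //.
rewrite derive_cst scaler0 addr0 derive_coord //.
by congr (_ + _); rewrite mulrC.
Qed.

(** The exterior derivative at [x] of the 1-form [A] on the coordinate space,
    evaluated on constant vector fields, which commute. *)
Definition dcoord (R : realType) m (A : 'rV[R]_m -> 'rV[R]_m -> R)
    (x v w : 'rV[R]_m) : R :=
  'D_v (fun y => A y w) x - 'D_w (fun y => A y v) x.

(** The pulled back form differentiates to the pullback of the exterior
    derivative plus a term linear in the second derivative of [f], and the
    latter is symmetric in [v] and [w]. *)
Lemma dcoord_pullback (R : realType) n m (U : set 'rV[R]_n)
    (f : 'rV[R]_n -> 'rV[R]_m) (A : 'rV[R]_m -> 'rV[R]_m -> R)
    (x v w : 'rV[R]_n) :
  open U -> U x -> Ck 2 U f -> (forall y, scalar (A y)) ->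
  (forall w, differentiable (fun y => A y w) (f x)) ->
  dcoord (fun y w => A (f y) ('D_w f y)) x v w =
  dcoord A (f x) ('D_v f x) ('D_w f x).
Proof.
move=> Uo Ux f2 AL dA; have [df d2f] := f2.
have dfx := df x Ux.
have E u u' : 'D_u (fun y => A (f y) ('D_u' f y)) x =
    'D_('D_u f x) (fun y => A y ('D_u' f x)) (f x) +
    A (f x) ('D_u (fun y => 'D_u' f y) x).
  apply: etrans (@derive_contract _ _ _ (fun y => A (f y)) (fun y => 'D_u' f y)
    x u _ _ _) _.
  - by move=> y; exact: AL.
  - by move=> w'; apply: (@differentiable_comp _ _ _ _ f (fun y => A y w')).
  - exact: (d2f _).1.
  - by rewrite (@derive_comp _ _ _ _ f (fun y => A y ('D_u' f x))).
have cancel (a b c d : R) : c = d -> a + c - (b + d) = a - b.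
  by move=> ->; ring.
apply: etrans (congr2 (fun a b => a - b) (E v w) (E w v)) _.
have S := schwarz_row w v Uo Ux f2.
exact: (cancel _ _ _ _ (congr1 (A (f x)) S)).
Qed.

(** * Charts and tangent vectors *)

Lemma near_cinv (R : realType) m (T : topologicalType) (c : chart R m T)
    (O : set T) (p : T) :
  open O -> O p -> cdom c p -> \forall y \near cmap c p, O (cinv c y).
Proof.
move=> Oo Op cp.
have ic : (cmap c @` cdom c) (cmap c p) by exists p.
have := @cinv_continuous _ _ _ c _ ic.
by apply; rewrite (cmapK cp); exact: open_nbhs_nbhs.
Qed.

Lemma near_chart_image (R : realType) m (T : topologicalType)
    (c : chart R m T) (p : T) :
  cdom c p -> \forall y \near cmap c p, (cmap c @` cdom c) y.
Proof.
by move=> cp; apply: open_nbhs_nbhs; split; [exact: cimg_open|exists p].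
Qed.

Lemma open_chart_image (R : realType) m (T : topologicalType) (c : chart R m T)
    (O : set T) : open O -> open (cmap c @` (cdom c `&` O)).
Proof.
move=> Oo; rewrite openE => _ [p [cp Op] <-]; rewrite /interior.
apply: filterS2 (near_chart_image cp) (near_cinv Oo Op cp) => _ [q cq <-].
rewrite cmapK // => Oq.
by exists q.
Qed.

(** The chain rule in the form in which transition maps compose: the composite
    is known only near the point, and the base point of [g] only up to an
    equality. *)
Lemma diff_chain (R : realType) (V W X : normedModType R) (f : V -> W)
    (g : W -> X) (h : V -> X) (x w : V) (y : W) :
  f x = y -> differentiable f x -> differentiable g y ->
  (\near x, g (f x) = h x) -> 'd g y ('d f x w) = 'd h x w.
Proof.
move=> <- df dg gfh; have dgf : differentiable (fun y => g (f y)) x.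
  exact: (@differentiable_comp _ _ _ _ f g).
rewrite -(deriveE _ (near_eq_differentiable gfh dgf)) -(near_eq_derive w gfh).
by rewrite derive_comp // !deriveE.
Qed.

Lemma transition_differentiable (R : realType) m (M : manifold R m)
    (c c' : chart R m M) (p : M) :
  atlas c -> atlas c' -> cdom c p -> cdom c' p ->
  differentiable (cmap c' \o cinv c) (cmap c p).
Proof.
move=> ac ac' cp c'p.
by have [/(_ 1%N) [d _] _] := atlas_compatible ac ac'; apply: d; exists p.
Qed.

Lemma transition_inverse (R : realType) m (M : manifold R m)
    (c c' : chart R m M) (p : M) (w : 'rV[R]_m) :
  atlas c -> atlas c' -> cdom c p -> cdom c' p ->
  'd (cmap c \o cinv c') (cmap c' p) ('d (cmap c' \o cinv c) (cmap c p) w) = w.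
Proof.
move=> ac ac' cp c'p.
have E : (cmap c' \o cinv c) (cmap c p) = cmap c' p by rewrite /= cmapK.
rewrite (@diff_chain _ _ _ _ _ _ id) //.
- by rewrite (@diff_val _ _ _ _ _ _ _ (is_diff_id _)).
- exact: transition_differentiable.
- exact: transition_differentiable.
have near_c' := near_cinv (cdom_open c') c'p cp.
apply: filterS2 (near_chart_image cp) near_c' => _ [q cq <-].
by rewrite /= (cmapK cq) => c'q; rewrite cmapK.
Qed.

Lemma coordsK (R : realType) m (M : manifold R m) (c : chart R m M) (p : M)
  (w : 'rV[R]_m) : atlas c -> cdom c p -> frame c p (coords c p w) = w.
Proof.
move=> ac cp.
by apply: transition_inverse => //; [exact: chart_at_atlas|exact: chart_at_dom].
Qed.

Lemma frameK (R : realType) m (M : manifold R m) (c : chart R m M) (p : M)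
  (w : 'rV[R]_m) : atlas c -> cdom c p -> coords c p (frame c p w) = w.
Proof.
move=> ac cp.
by apply: transition_inverse => //; [exact: chart_at_atlas|exact: chart_at_dom].
Qed.

Lemma diff_self_transition (R : realType) m (T : topologicalType)
    (c : chart R m T) (p : T) (w : 'rV[R]_m) :
  cdom c p -> 'd (cmap c \o cinv c) (cmap c p) w = w.
Proof.
move=> cp; have nc : \forall y \near cmap c p, y = (cmap c \o cinv c) y.
  by apply: filterS (near_chart_image cp) => _ [q cq <-] /=; rewrite cmapK.
rewrite -deriveE -?(near_eq_derive _ nc) ?derive_id //.
exact: near_eq_differentiable nc _.
Qed.

Lemma frame_chart_at (R : realType) m (M : manifold R m) (p : M)
  (w : 'rV[R]_m) : frame (chart_at p) p w = w.
Proof. exact/diff_self_transition/chart_at_dom. Qed.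

Lemma form_in_scalar (R : realType) m (M : manifold R m) (c : chart R m M)
  (a : one_form M) x : scalar (form_in c a x).
Proof. by move=> s u w; rewrite /form_in /frame !linearP. Qed.

Definition local_rep (R : realType) n m (N : manifold R n) (M : manifold R m)
    (i : N -> M) (c : chart R n N) (c' : chart R m M) :
  'rV[R]_n -> 'rV[R]_m := cmap c' \o i \o cinv c.

Definition local_rep_dom (R : realType) n m (N : manifold R n)
    (M : manifold R m) (i : N -> M) (c : chart R n N) (c' : chart R m M) :
  set 'rV[R]_n := cmap c @` (cdom c `&` i @^-1` cdom c').

Lemma open_local_rep_dom (R : realType) n m (N : manifold R n)
    (M : manifold R m) (i : N -> M) (c : chart R n N) (c' : chart R m M) :
  smooth_map i -> open (local_rep_dom i c c').
Proof.
move=> [ic _]; apply: open_chart_image.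
by apply: open_comp; [move=> x _; exact: ic|exact: cdom_open].
Qed.

Lemma differentiable_local_rep (R : realType) n m (N : manifold R n)
    (M : manifold R m) (i : N -> M) (c : chart R n N) (c' : chart R m M)
    (x : N) :
  smooth_map i -> atlas c -> atlas c' -> cdom c x -> cdom c' (i x) ->
  differentiable (local_rep i c c') (cmap c x).
Proof.
move=> [_ si] ac ac' cx c'ix; have [d _] := si _ _ ac ac' 1%N.
by apply: d; exists x.
Qed.

(** Both sides are the derivative at [cmap c x] of the map [i] read in [c] and
    in the preferred chart of [i x]. *)
Lemma tmap_local_rep (R : realType) n m (N : manifold R n)
    (M : manifold R m) (i : N -> M) (c : chart R n N) (c' : chart R m M)
    (x : N) (w : 'rV[R]_n) :
  smooth_map i -> atlas c -> atlas c' -> cdom c x -> cdom c' (i x) ->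
  tmap i x (frame c x w) = frame c' (i x) ('D_w (local_rep i c c') (cmap c x)).
Proof.
move=> si ac ac' cx c'ix.
set C := chart_at x; set C' := chart_at (i x).
have aC : atlas C by exact: chart_at_atlas.
have aC' : atlas C' by exact: chart_at_atlas.
have Cx : cdom C x by exact: chart_at_dom.
have C'ix : cdom C' (i x) by exact: chart_at_dom.
have ic : continuous i := si.1.
have nO (O : set M) : open O -> O (i x) ->
    \forall y \near cmap c x, O (i (cinv c y)).
  move=> Oo Oix; apply: (@near_cinv _ _ _ c (i @^-1` O)) => //.
  by apply: open_comp => // z _; exact: ic.
transitivity ('d (local_rep i c C') (cmap c x) w).
  have E : (cmap C \o cinv c) (cmap c x) = cmap C x by rewrite /= cmapK.
  rewrite /tmap /frame -/C -/C'.
  apply: (@diff_chain _ _ _ _ (cmap C \o cinv c) (local_rep i C C')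
    (local_rep i c C') _ _ _ E).
  - exact: transition_differentiable.
  - exact: (@differentiable_local_rep _ _ _ _ _ i).
  apply: filterS (near_cinv (cdom_open C) Cx cx) => y Cy.
  by rewrite /local_rep /= cmapK.
rewrite deriveE; last exact: differentiable_local_rep.
have E : local_rep i c c' (cmap c x) = cmap c' (i x).
  by rewrite /local_rep /= cmapK.
rewrite /frame -/C'; apply: esym.
apply: (@diff_chain _ _ _ _ (local_rep i c c') (cmap C' \o cinv c')
  (local_rep i c C') _ _ _ E).
- exact: differentiable_local_rep.
- exact: transition_differentiable.
apply: filterS (nO _ (cdom_open c') c'ix) => y c'y.
by rewrite /local_rep /= cmapK.
Qed.

Lemma form_in_pullback (R : realType) n m (N : manifold R n)
    (M : manifold R m) (i : N -> M) (lam : one_form M)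
    (c : chart R n N) (c' : chart R m M) (y w : 'rV[R]_n) :
  smooth_map i -> atlas c -> atlas c' -> local_rep_dom i c c' y ->
  form_in c (pullback i lam) y w =
  form_in c' lam (local_rep i c c' y) ('D_w (local_rep i c c') y).
Proof.
move=> si ac ac' [x [cx c'ix] <-].
have E : cinv c' (local_rep i c c' (cmap c x)) = i x.
  by rewrite /local_rep /= (cmapK cx) (cmapK c'ix).
by rewrite /form_in E (cmapK cx) /pullback /=
  (tmap_local_rep w si ac ac' cx c'ix).
Qed.

Lemma smooth_pullback (R : realType) n m (N : manifold R n)
    (M : manifold R m) (i : N -> M) (lam : one_form M) :
  smooth_map i -> smooth_form lam -> smooth_form (pullback i lam).
Proof.
move=> si sl c ac w k; apply: Ck_local => _ [x [cx _] <-].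
set c' := chart_at (i x).
have ac' : atlas c' by exact: chart_at_atlas.
have c'ix : cdom c' (i x) by exact: chart_at_dom.
have Uo : open (local_rep_dom i c c') by exact: open_local_rep_dom.
exists (local_rep_dom i c c'); first by exists x.
apply: (eq_Ck Uo (fun y Uy => esym (form_in_pullback lam w si ac ac' Uy))).
apply: (@Ck_contract _ _ _ _ _
  (fun y => form_in c' lam (local_rep i c c' y))) => //.
- by move=> y; exact: form_in_scalar.
- move=> w'; apply: (@Ck_comp _ _ _ _ _ (cmap c' @` (cdom c' `&` setT))
     (local_rep i c c') (fun z => form_in c' lam z w')) => //.
  + move=> _ [z [cz c'iz] <-]; rewrite /local_rep /= cmapK //.
    by exists (i z).
  + exact: si.2.
  + exact: sl.
exact: (si.2 _ _ ac ac' k.+1).2.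
Qed.

Lemma eq_dcoord (R : realType) m (A B : 'rV[R]_m -> 'rV[R]_m -> R)
    (x v w : 'rV[R]_m) :
  (forall w, \near x, A x w = B x w) -> dcoord A x v w = dcoord B x v w.
Proof.
by move=> AB; congr (_ - _); apply: near_eq_derive; exact: AB.
Qed.

Lemma form_in_differentiable (R : realType) m (M : manifold R m)
    (c : chart R m M) (a : one_form M) (p : M) (w : 'rV[R]_m) :
  smooth_form a -> atlas c -> cdom c p ->
  differentiable (fun y => form_in c a y w) (cmap c p).
Proof. by move=> sa ac cp; apply: (sa c ac w 1%N).1; exists p. Qed.

Lemma dcoord_form_pullback (R : realType) n m (N : manifold R n)
    (M : manifold R m) (i : N -> M) (lam : one_form M)
    (c : chart R n N) (c' : chart R m M) (x : N) (v w : 'rV[R]_n) :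
  smooth_map i -> smooth_form lam ->
  atlas c -> atlas c' -> cdom c x -> cdom c' (i x) ->
  dcoord (form_in c (pullback i lam)) (cmap c x) v w =
  dcoord (form_in c' lam) (cmap c' (i x))
    ('D_v (local_rep i c c') (cmap c x)) ('D_w (local_rep i c c') (cmap c x)).
Proof.
move=> si sl ac ac' cx c'ix.
have Uo : open (local_rep_dom i c c') by exact: open_local_rep_dom.
have Ux : local_rep_dom i c c' (cmap c x) by exists x.
have E : local_rep i c c' (cmap c x) = cmap c' (i x).
  by rewrite /local_rep /= cmapK.
rewrite -[in RHS]E -(@dcoord_pullback _ _ _ _ _ (form_in c' lam) _ _ _ Uo Ux).
- apply: eq_dcoord => u.
  have nU := open_nbhs_nbhs (conj Uo Ux).
  by apply: filterS nU => y Uy; exact: form_in_pullback.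
- exact: si.2 _ _ ac ac' 2%N.
- by move=> y; exact: form_in_scalar.
- by move=> u; rewrite E; exact: form_in_differentiable.
Qed.

(** * Invariant formulas for the exterior and Lie derivatives *)

Lemma smooth_map_id (R : realType) m (M : manifold R m) :
  smooth_map (id : M -> M).
Proof.
split=> [p|c c' ac ac']; first exact: cvg_id.
exact: (atlas_compatible ac ac').1.
Qed.

(** Makes a change of chart the case of the identity map in the naturality of
    the exterior derivative. *)
Lemma form_in_pullback_id (R : realType) m (M : manifold R m)
    (lam : one_form M) (c : chart R m M) :
  form_in c (pullback (id : M -> M) lam) = form_in c lam.
Proof.
apply/funext => y; apply/funext => w; rewrite /form_in /pullback /=.
by congr (lam _ _); exact/diff_self_transition/chart_at_dom.
Qed.

Lemma dform_chart (R : realType) m (M : manifold R m) (lam : one_form M)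
    (c : chart R m M) (p : M) (v w : 'rV[R]_m) :
  smooth_form lam -> atlas c -> cdom c p ->
  dform lam p v w =
  dcoord (form_in c lam) (cmap c p) (coords c p v) (coords c p w).
Proof.
move=> sl ac cp; have aC := chart_at_atlas p; have Cp := chart_at_dom p.
have := dcoord_form_pullback v w (smooth_map_id M) sl aC ac Cp cp.
rewrite form_in_pullback_id !deriveE //;
  exact: (differentiable_local_rep (smooth_map_id M)).
Qed.

Lemma dform_pullback (R : realType) n m (N : manifold R n) (M : manifold R m)
    (i : N -> M) (lam : one_form M) (x : N) (v w : 'rV[R]_n) :
  smooth_map i -> smooth_form lam ->
  dform (pullback i lam) x v w = dform lam (i x) (tmap i x v) (tmap i x w).
Proof.
move=> si sl; have aC := chart_at_atlas x; have Cx := chart_at_dom x.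
have aC' := chart_at_atlas (i x); have C'x := chart_at_dom (i x).
have := dcoord_form_pullback v w si sl aC aC' Cx C'x.
by rewrite !deriveE //; exact: differentiable_local_rep.
Qed.

Lemma dformN (R : realType) m (M : manifold R m) (lam : one_form M)
    (p : M) (v w : 'rV[R]_m) : dform lam p v w = - dform lam p w v.
Proof. by rewrite /dform opprB. Qed.

Lemma dform_scalar (R : realType) m (M : manifold R m) (lam : one_form M)
    (p : M) (v : 'rV[R]_m) : smooth_form lam -> scalar (dform lam p v).
Proof.
move=> sl s u w; set c := chart_at p.
have df z : differentiable (fun x => form_in c lam x z) (cmap c p).
  by apply: form_in_differentiable => //;
     [exact: chart_at_atlas|exact: chart_at_dom].
rewrite /dform -/c (deriveE (s *: u + w) (df v)) linearP -!(deriveE _ (df v)).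
have -> : (fun x => form_in c lam x (s *: u + w)) =
    s *: (fun x => form_in c lam x u) + (fun x => form_in c lam x w).
  by apply/funext => x; rewrite form_in_scalar.
rewrite deriveD; last 2 first.
- by apply: derivableZ; exact: diff_derivable.
- exact: diff_derivable.
rewrite deriveZ; last exact: diff_derivable.
have regroup (a b d e : R) :
    s *: a + b - (s *: d + e) = s *: (a - d) + (b - e).
  by rewrite scalerBr opprD addrACA.
exact: regroup.
Qed.

(** Cartan's formula for a form that vanishes on [u]: differentiating
    [a u = 0] in the direction [w] exchanges the term of [L_u a] that
    differentiates [u] for the second term of [d a]. *)
Lemma lie_form_dform (R : realType) m (M : manifold R m) (a : one_form M)
    (u : vector_field M) (x : M) (w : 'rV[R]_m) :
  smooth_form a -> smooth_vf u -> (forall p, a p (u p) = 0) ->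
  lie_form u a x w = dform a x (u x) w.
Proof.
move=> sa su au; set c := chart_at x.
have ac : atlas c := chart_at_atlas x; have cx : cdom c x := chart_at_dom x.
have ic : (cmap c @` cdom c) (cmap c x) by exists x.
have near0 : \forall y \near cmap c x,
    form_in c a y (vf_in c u y) = 0.
  apply: filterS (near_chart_image cx) => _ [q cq <-].
  by rewrite /form_in /vf_in (cmapK cq) coordsK.
have ux : vf_in c u (cmap c x) = u x.
  by rewrite /vf_in (cmapK cx); exact: diff_self_transition.
have ax z : form_in c a (cmap c x) z = a x z.
  by rewrite /form_in (cmapK cx) frame_chart_at.
have := near_eq_derive w near0.
rewrite derive_cst (@derive_contract _ _ _ (form_in c a)).
- rewrite ux ax => /eqP; rewrite addr_eq0 => /eqP E.
  by rewrite /lie_form /dform -/c E opprK.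
- by move=> y; exact: form_in_scalar.
- by move=> z; exact: form_in_differentiable.
- exact: (su c ac 1%N).1.
Qed.

(** * Forms vanishing along a foliation *)

(** Tangency can be tested in a single foliated chart: by coherence, a
    transition map between foliated charts sends a line of the plaque of [q]
    into a plaque, so its transverse coordinates are constant along this line
    and have zero derivative. *)
Lemma tangent_of_chart (R : realType) m (M : manifold R m) k (G : foliation M k)
    (c : chart R m M) (q : M) (w : 'rV[R]_m) :
  fatlas G c -> cdom c q ->
  (forall j : 'I_m, (k <= j)%N -> coords c q w 0 j = 0) -> tangent G q w.
Proof.
move=> fc cq w0 c' fc' c'q j kj.
have ac : atlas c := fatlas_atlas fc; have ac' : atlas c' := fatlas_atlas fc'.
have dT := transition_differentiable ac ac' cq c'q.
set e := coords c q w in w0.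
have -> : coords c' q w = 'D_e (cmap c' \o cinv c) (cmap c q).
  rewrite deriveE // /e /coords; apply/esym/diff_chain.
  - by rewrite /= cmapK //; exact: chart_at_dom.
  - by apply: transition_differentiable => //;
       [exact: chart_at_atlas|exact: chart_at_dom].
  - exact: transition_differentiable.
  apply: filterS (near_cinv (cdom_open c) cq (chart_at_dom q)) => y cy.
  by rewrite /= cmapK.
rewrite derive_coord //; set h := fun y => _.
have [W nW plaque] := fatlas_coherent fc fc' cq c'q.
have hline : \forall t \near (0 : R), h (cmap c q + t *: e) = h (cmap c q).
  have n1 := near_chart_image cq.
  have n2 := near_cinv (@open_interior _ W) nW cq.
  have cl : {for (0 : R), continuous (fun t : R => cmap c q + t *: e)}.
    by apply: differentiable_continuous; exact: differentiableD.
  pose P := (cmap c @` cdom c) `&` (cinv c @^-1` W^°).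
  have nP : nbhs (cmap c q + 0 *: e) P.
    by rewrite scale0r addr0; exact: filterI n1 n2.
  have nl : \forall t \near (0 : R), P (cmap c q + t *: e) := cl P nP.
  apply: filterS nl => t [[r cr rE] /interior_subset]; rewrite -rE /=.
  rewrite cmapK // => Wr.
  have [|_ _ /(_ j kj)] := plaque q r (nbhs_singleton nW) Wr.
    split=> // j' kj'; by rewrite rE !mxE w0 // mulr0 addr0.
  by rewrite /h /= !cmapK.
(* The base point is written as the value at 0 of the line directed by [e]. *)
have hd : differentiable h (cmap c q + 0 *: e).
  rewrite scale0r addr0.
  apply: (@differentiable_comp _ _ _ _ (cmap c' \o cinv c)
    (fun M => M 0 j)) => //.
  exact: differentiable_coord.
have := @derive_val _ _ _ _ _ _ _ (derivable_line hd).
by rewrite (near_eq_derive _ hline) derive_cst scale0r addr0.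
Qed.

(** In a foliated chart of [G] the components of [lam] along the plaques vanish
    identically, and [d lam (v, w)] only differentiates such components. *)
Lemma dform_integral (R : realType) m (M : manifold R m) k
    (G : foliation M k) (lam : one_form M) (p : M) (v w : 'rV[R]_m) :
  smooth_form lam -> (forall q u, tangent G q u -> lam q u = 0) ->
  tangent G p v -> tangent G p w -> dform lam p v w = 0.
Proof.
move=> sl lamG Gv Gw; have [c fc cp] := fatlas_cover G p.
have ac : atlas c := fatlas_atlas fc.
have const0 u u' : tangent G p u ->
    'D_u' (fun y => form_in c lam y (coords c p u)) (cmap c p) = 0.
  move=> Gu; rewrite -[RHS](derive_cst (0 : R) (cmap c p) u').
  apply: near_eq_derive.
  apply: filterS (near_chart_image cp) => _ [q cq <-].
  rewrite /form_in (cmapK cq); apply: lamG.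
  apply: (tangent_of_chart fc cq) => j kj; rewrite frameK //; exact: Gu.
by rewrite (dform_chart _ _ sl ac cp) /dcoord !const0 // subr0.
Qed.

Lemma tangent_lin (R : realType) m (M : manifold R m) k (F : foliation M k)
  (p : M) (s : R) (v w : 'rV[R]_m) :
  tangent F p v -> tangent F p w -> tangent F p (s *: v + w).
Proof.
move=> Fv Fw c fc cp j kj.
by rewrite /coords linearP !mxE Fv // Fw // mulr0 addr0.
Qed.

Theorem lemma3p5 (R : realType) (n : nat) (n_gt0 : (0 < n)%N)
    (M : manifold R (2 * n - 1)) (xi : plane_field M)
    (xi_contact : contact_structure xi)
    (lam : one_form M) (lam_contact : contact_form xi lam)
    (F : foliation M n) (F_coleg : co_legendrian xi F)
    (G : foliation M (n - 1)) (G_leg : legendrian_of xi F G)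
    (v : vector_field M) (v_reeb : reeb_field lam v)
    (v_tangent : forall p, tangent F p (v p))
    (L : manifold R n) (i : L -> M) (L_leaf : is_leaf F i) :
  holonomy_invariant_transverse_measure
    (preimage_plane_field i (tangent G)) (pullback i lam).
Proof.
have [sl lam_ker] := lam_contact.
have [_ v_dlam v_lam] := v_reeb.
have [si _ _ i_range _] := L_leaf.
have tangentGE p w : tangent G p w <-> tangent F p w /\ lam p w = 0.
  by rewrite (G_leg p) /dist_cap -(lam_ker p).
have sa := smooth_pullback si sl.
split=> // u su Gu.
have au x : pullback i lam x (u x) = 0.
  exact: ((tangentGE _ _).1 (Gu x)).2.
split=> // x w.
rewrite lie_form_dform // dform_pullback //.
set U := tmap i x (u x); set W := tmap i x w.
have FW : tangent F (i x) W by rewrite -i_range; exists w.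
(* [W] splits into its Reeb component and a vector tangent to [G]. *)
set s := lam (i x) W; set g := - s *: v (i x) + W.
have Gg : tangent G (i x) g.
  apply/tangentGE; split; first exact: tangent_lin.
  by rewrite linearP v_lam /= mulr1 addNr.
have -> : W = s *: v (i x) + g by rewrite /g scaleNr addNKr.
rewrite dform_scalar // dformN v_dlam oppr0 mulr0 add0r.
apply: (dform_integral sl _ (Gu x) Gg) => q z /tangentGE[_ ]; exact.
Qed.
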